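(* Let $M\subseteq\mathbb R^4$ be a connected open set with coordinates $(x,r,x^3,x^4)$, let $h=h(x,x^3,x^4)$ and $f=f(x^3,x^4)$ be nowhere vanishing smooth functions on $M$, and let $g$ be the generalized pp-wave metric $$ds^2=-2h\,(dx)^2+2\,dx\,dr-\tfrac12 f\,[(dx^3)^2+(dx^4)^2].$$ Put $\alpha=\dfrac{f_3^2+f_4^2-f f_{33}-f f_{44}}{f^3}$. Then $(M,g)$ has the following properties. (i) It is Ricci generalized pseudosymmetric such that $R\cdot R=Q(S,R)$. (ii) It is 2-quasi-Einstein, since $\operatorname{rank}(S-\alpha g)=2$. (iii) It is generalized quasi-Einstein in the sense of Chaki: $S=\alpha g+\eta\otimes\eta+(\eta\otimes\delta+\delta\otimes\eta)$, where $\eta$ and $\delta$ are the 1-forms with components $\eta=\{1,0,0,0\}$ and $$\delta=\left\{\frac{2f^2(h_{33}+h_{44})-2(f_{33}+f_{44})fh+2(f_3^2+f_4^2)h-f^3}{2f^3},\ \frac{f(f_{33}+f_{44})-f_3^2-f_4^2}{f^3},\ 0,\ 0\right\}.$$ (iv) The Ricci tensor $S$ is Riemann compatible as well as Weyl compatible. (v) It is an $Ein(3)$ manifold such that $$S^2=-\frac{f_3^2+f_4^2-f(f_{33}+f_{44})}{f^3}\,S^3.$$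
   Context: Coordinates $(x,r,x^3,x^4)$ are numbered $1,2,3,4$; a subscript on $f$ or $h$ denotes a partial derivative with respect to the coordinate so numbered (e.g. $h_1=\partial h/\partial x$, $f_{33}=\partial^2 f/(\partial x^3)^2$). A 1-form is written by its components $\{\cdot,\cdot,\cdot,\cdot\}$ in the coordinate coframe. Sign conventions: with $\nabla$ the Levi-Civita connection, $\mathcal R(X,Y)Z=\nabla_Y\nabla_XZ-\nabla_X\nabla_YZ+\nabla_{[X,Y]}Z$, $R(X_1,X_2,X_3,X_4)=g(\mathcal R(X_1,X_2)X_3,X_4)$, and $S(Y,Z)=\operatorname{tr}(X\mapsto\mathcal R(X,Y)Z)$, i.e. $S_{jk}=g^{il}R_{ijkl}$; $\kappa$ is the $g$-trace of $S$. (For example $R_{1313}=\frac{-f_3h_3+f_4h_4+2fh_{33}}{2f}$ and $S_{11}=\frac{2(h_{33}+h_{44})}{f}$.) For a $(0,4)$-tensor $D$, $\mathcal D$ is the $(1,3)$-tensor with $D(X_1,X_2,X_3,X_4)=g(\mathcal D(X_1,X_2)X_3,X_4)$. For a $(0,k)$-tensor $B$, $$(D\cdot B)(X_1,\dots,X_k,X,Y)=-B(\mathcal D(X,Y)X_1,X_2,\dots,X_k)-\cdots-B(X_1,\dots,\mathcal D(X,Y)X_k).$$ For a symmetric $(0,2)$-tensor $A$, put $(X\wedge_AY)Z=A(Y,Z)X-A(X,Z)Y$ and $$Q(A,B)(X_1,\dots,X_k,X,Y)=-B((X\wedge_AY)X_1,X_2,\dots,X_k)-\cdots-B(X_1,\dots,(X\wedge_AY)X_k).$$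 The Kulkarni-Nomizu product of symmetric $(0,2)$-tensors is $(A\wedge E)(X_1,X_2,X_3,X_4)=A(X_1,X_4)E(X_2,X_3)+A(X_2,X_3)E(X_1,X_4)-A(X_1,X_3)E(X_2,X_4)-A(X_2,X_4)E(X_1,X_3)$. In dimension 4 the conformal (Weyl) curvature tensor is $C=R-\frac12(g\wedge S)+\frac{\kappa}{12}(g\wedge g)$. For a symmetric $(0,2)$-tensor $A$ with endomorphism $\mathcal A$ ($g(\mathcal AX,Y)=A(X,Y)$), $A^k(X,Y)=A(\mathcal A^{k-1}X,Y)$. A manifold is $Ein(3)$ if $S^3+\lambda_3S^2+\lambda_4S+\lambda_5g=0$ for some scalars $\lambda_i$. It is 2-quasi-Einstein if at each point $\operatorname{rank}(S-\alpha g)\le2$ for a scalar $\alpha$. It is generalized quasi-Einstein in the sense of Chaki if $S=\alpha g+\beta\,\Pi\otimes\Pi+\gamma(\Pi\otimes\Omega+\Omega\otimes\Pi)$ for some scalars $\alpha,\beta,\gamma$ and 1-forms $\Pi,\Omega$. A symmetric $(0,2)$-tensor $E$ with endomorphism $\mathcal E$ is $D$-compatible if $D(\mathcal EX_1,X,X_2,X_3)+D(\mathcal EX_2,X,X_3,X_1)+D(\mathcal EX_3,X,X_1,X_2)=0$ for all vector fields; Riemann (Weyl) compatible means $R$-compatible ($C$-compatible).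
   Formalization: In (ii), rank(S−αg)=2 is claimed only where α≠0, with rank ≤2 everywhere (f=h=1 gives rank 0). In (v), the printed S²=−αS³ fails wherever α≠0 and is replaced by S³=αS², the Ein(3) relation that holds. *)

(* Defs.v *)
From HB Require Import structures.
From mathcomp Require Import all_boot all_order all_algebra.
From mathcomp Require Import all_classical all_reals all_analysis.

Set Implicit Arguments.
Unset Strict Implicit.
Unset Printing Implicit Defensive.

Import Order.TTheory GRing.Theory Num.Theory.
Import numFieldNormedType.Exports.

Local Open Scope classical_set_scope.
Local Open Scope ring_scope.

(* The coordinates (x, r, x^3, x^4) are numbered 1, 2, 3, 4, so that [c1] is
   the index of x, [c2] that of r, and so on. *)
Definition c1 : 'I_4 := @Ordinal 4 0 isT.
Definition c2 : 'I_4 := @Ordinal 4 1 isT.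
Definition c3 : 'I_4 := @Ordinal 4 2 isT.
Definition c4 : 'I_4 := @Ordinal 4 3 isT.

Definition ebase {R : realType} (i : 'I_4) : 'rV[R]_4 := delta_mx 0 i.

Definition pd {R : realType} (i : 'I_4) (F : 'rV[R]_4 -> R) : 'rV[R]_4 -> R :=
  fun p => 'D_(ebase i) F p.

(* C^infinity on an open set: all iterated partial derivatives exist and are
   continuous at every point of the set. *)
Definition smooth_on {R : realType} (M : set 'rV[R]_4) (F : 'rV[R]_4 -> R) :=
  forall (s : seq 'I_4) (p : 'rV[R]_4), M p ->
    {for p, continuous (foldr pd F s)} /\
    forall i, derivable (foldr pd F s) p (ebase i).

Definition depends_only_on {R : realType} (M : set 'rV[R]_4) (s : seq 'I_4)
    (F : 'rV[R]_4 -> R) :=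
  forall p q, M p -> M q -> (forall i, i \in s -> p 0 i = q 0 i) -> F p = F q.

(* At a point, vectors and 1-forms are the rows of their components, a
   (0,2)-tensor [A] is the matrix of its components, A(X,Y) = X A Y^T, and a
   (0,4)-tensor is a function of four vectors. *)
Definition ev2 {R : realType} (A : 'M[R]_4) (X Y : 'rV[R]_4) : R :=
  (X *m A *m Y^T) 0 0.

Definition tensor4 (R : realType) :=
  'rV[R]_4 -> 'rV[R]_4 -> 'rV[R]_4 -> 'rV[R]_4 -> R.

Definition otimes {R : realType} (P W : 'rV[R]_4) : 'M[R]_4 := P^T *m W.

Section Connection.
Context {R : realType}.
Local Notation V := 'rV[R]_4.
Implicit Types (g : V -> 'M[R]_4).

Definition christoffel g (k i j : 'I_4) (p : V) : R :=
  2^-1 * \sum_(l < 4) invmx (g p) k l *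
    (pd i (fun q => g q j l) p + pd j (fun q => g q i l) p
     - pd l (fun q => g q i j) p).

Definition nabla g (X Y : V -> V) : V -> V := fun p =>
  \row_k \sum_(i < 4) X p 0 i *
    (pd i (fun q => Y q 0 k) p + \sum_(j < 4) christoffel g k i j p * Y p 0 j).

Definition lie (X Y : V -> V) : V -> V := fun p =>
  \row_k \sum_(i < 4) (X p 0 i * pd i (fun q => Y q 0 k) p
                       - Y p 0 i * pd i (fun q => X q 0 k) p).

Definition curv_op g (X Y Z : V -> V) : V -> V := fun p =>
  nabla g Y (nabla g X Z) p - nabla g X (nabla g Y Z) p
  + nabla g (lie X Y) Z p.

(* The curvature is tensorial, so its value on vectors at [p] may be computed
   on their extensions to vector fields with constant components. *)
Definition curv_at g (p X Y Z : V) : V :=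
  curv_op g (fun=> X) (fun=> Y) (fun=> Z) p.

Definition riemann g (p : V) : tensor4 R := fun X1 X2 X3 X4 =>
  ev2 (g p) (curv_at g p X1 X2 X3) X4.

(* [lin1_mx] is the matrix of a linear map acting on row vectors. *)
Definition ricci g (p : V) : 'M[R]_4 :=
  \matrix_(j, k) \tr (lin1_mx (fun X => curv_at g p X (ebase j) (ebase k))).

Definition scalar_curv g (p : V) : R := \tr (invmx (g p) *m ricci g p).

End Connection.

Section TensorAlgebra.
Context {R : realType}.
Local Notation V := 'rV[R]_4.
(* Here [g] is the metric at one point. *)
Implicit Types (g A E : 'M[R]_4) (D B : tensor4 R).

(* The (1,3)-tensor with D(X1,X2,X3,X4) = g(sharp4 g D X1 X2 X3, X4). *)
Definition sharp4 g D (X1 X2 X3 : V) : V :=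
  (\row_l D X1 X2 X3 (ebase l)) *m invmx g.

(* The endomorphism with g(sharp2 g A X, Y) = A(X,Y). *)
Definition sharp2 g A (X : V) : V := X *m A *m invmx g.

(* A^k(X,Y) = A(sharp2^(k-1) X, Y), for k > 0. *)
Definition tpow2 g A (k : nat) : 'M[R]_4 := (A *m invmx g) ^+ k.-1 *m A.

Definition dot4 g D B (X1 X2 X3 X4 X Y : V) : R :=
  - B (sharp4 g D X Y X1) X2 X3 X4 - B X1 (sharp4 g D X Y X2) X3 X4
  - B X1 X2 (sharp4 g D X Y X3) X4 - B X1 X2 X3 (sharp4 g D X Y X4).

Definition wedge_op A (X Y Z : V) : V := ev2 A Y Z *: X - ev2 A X Z *: Y.

Definition tachibana4 A B (X1 X2 X3 X4 X Y : V) : R :=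
  - B (wedge_op A X Y X1) X2 X3 X4 - B X1 (wedge_op A X Y X2) X3 X4
  - B X1 X2 (wedge_op A X Y X3) X4 - B X1 X2 X3 (wedge_op A X Y X4).

Definition kulkarni_nomizu A E : tensor4 R := fun X1 X2 X3 X4 =>
  ev2 A X1 X4 * ev2 E X2 X3 + ev2 A X2 X3 * ev2 E X1 X4
  - ev2 A X1 X3 * ev2 E X2 X4 - ev2 A X2 X4 * ev2 E X1 X3.

Definition compatible g D E :=
  forall X X1 X2 X3 : V,
    D (sharp2 g E X1) X X2 X3 + D (sharp2 g E X2) X X3 X1
    + D (sharp2 g E X3) X X1 X2 = 0.

End TensorAlgebra.

Section CurvatureConditions.
Context {R : realType}.
Local Notation V := 'rV[R]_4.
Implicit Types (M : set V) (g : V -> 'M[R]_4).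

Definition weyl g (p : V) : tensor4 R := fun X1 X2 X3 X4 =>
  riemann g p X1 X2 X3 X4
  - 2^-1 * kulkarni_nomizu (g p) (ricci g p) X1 X2 X3 X4
  + scalar_curv g p / 12%:R * kulkarni_nomizu (g p) (g p) X1 X2 X3 X4.

Definition ricci_gen_pseudosymmetric M g (L : V -> R) :=
  forall p, M p -> forall X1 X2 X3 X4 X Y : V,
    dot4 (g p) (riemann g p) (riemann g p) X1 X2 X3 X4 X Y
    = L p * tachibana4 (ricci g p) (riemann g p) X1 X2 X3 X4 X Y.

Definition two_quasi_Einstein M g :=
  forall p, M p -> exists a : R, (\rank (ricci g p - a *: g p)%R <= 2)%N.

Definition chaki_form (gp : 'M[R]_4) (a b c : R) (P W : V) : 'M[R]_4 :=
  a *: gp + b *: otimes P P + c *: (otimes P W + otimes W P).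

Definition chaki_gen_quasi_Einstein M g :=
  exists (a b c : V -> R) (P W : V -> V), forall p, M p ->
    ricci g p = chaki_form (g p) (a p) (b p) (c p) (P p) (W p).

Definition riemann_compatible M g (E : V -> 'M[R]_4) :=
  forall p, M p -> compatible (g p) (riemann g p) (E p).

Definition weyl_compatible M g (E : V -> 'M[R]_4) :=
  forall p, M p -> compatible (g p) (weyl g p) (E p).

Definition Ein3 M g :=
  exists l3 l4 l5 : V -> R, forall p, M p ->
    tpow2 (g p) (ricci g p) 3 + l3 p *: tpow2 (g p) (ricci g p) 2
    + l4 p *: ricci g p + l5 p *: g p = 0.

End CurvatureConditions.

Section GeneralizedPpWave.
Context {R : realType}.
Local Notation V := 'rV[R]_4.
Variables (h f : V -> R).

(* ds^2 = -2h (dx)^2 + 2 dx dr - (f/2) [(dx^3)^2 + (dx^4)^2]. *)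
Definition ppwave (p : V) : 'M[R]_4 :=
  (- (2 * h p)) *: delta_mx c1 c1 + (delta_mx c1 c2 + delta_mx c2 c1)
  - (f p / 2) *: (delta_mx c3 c3 + delta_mx c4 c4).

Definition ppw_alpha (p : V) : R :=
  (pd c3 f p ^+ 2 + pd c4 f p ^+ 2
   - f p * pd c3 (pd c3 f) p - f p * pd c4 (pd c4 f) p) / f p ^+ 3.

Definition ppw_eta : V := ebase c1.

Definition ppw_delta (p : V) : V :=
  ((2 * f p ^+ 2 * (pd c3 (pd c3 h) p + pd c4 (pd c4 h) p)
    - 2 * (pd c3 (pd c3 f) p + pd c4 (pd c4 f) p) * f p * h p
    + 2 * (pd c3 f p ^+ 2 + pd c4 f p ^+ 2) * h p - f p ^+ 3)
   / (2 * f p ^+ 3)) *: ebase c1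
  + ((f p * (pd c3 (pd c3 f) p + pd c4 (pd c4 f) p)
      - pd c3 f p ^+ 2 - pd c4 f p ^+ 2) / f p ^+ 3) *: ebase c2.

End GeneralizedPpWave.

(* Main.v *)
Require Import Defs.
From HB Require Import structures.
From mathcomp Require Import all_boot all_order all_algebra.
From mathcomp Require Import all_classical all_reals all_analysis.
From mathcomp Require Import ring.

(** The vector field [d/dr] is null and parallel, so the curvature is a
    symmetric bilinear form on the bivectors modulo those that contain it.  On
    the components [u3], [u4], [w] of a bivector along [e1 /\ e3], [e1 /\ e4],
    [e3 /\ e4] the form is
      [a33 u3 v3 + a34 (u3 v4 + u4 v3) + a44 u4 v4 + rho w z],
    with no mixed terms between the [u]'s and [w] since [f] does not depend on
    [x] ([curv_at_ppwave], [riemann_ppwave]).  That the remaining components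
    vanish and that [a34] is unambiguous rests on the symmetry of second
    derivatives ([derive_comm]).

    Contracting, the Ricci tensor is [s dx^2] plus [sigma] times the Euclidean
    form of the plane [(e3, e4)], where [s = 2 (a33 + a44) / f] and
    [sigma = 2 rho / f = - alpha f / 2] ([ricci_ppwave]).  Everything else is
    algebra at one point with these two tensors.

    - [R . R = Q(S, R)].  Both sides let an endomorphism act on [R] as a
      derivation: the curvature operator on the left, [X /\_S Y] on the right.
      On the plane [(e3, e4)] the two endomorphisms agree, as on any surface;
      their other components differ, but the differences cancel in [R] because
      [s] is, up to the factor [2 / f], the trace of [a] ([dot4_curv_form]).
    - [S - alpha g] is [eta (x) eta + eta (x) delta + delta (x) eta], so its
      rank is at most 2.  It vanishes outside the [(e1, e2)] block, whose
      determinant is [- alpha^2], so the rank is 2 where [alpha <> 0]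
      ([rank_wave2]).
    - [S] is Riemann compatible since the Ricci endomorphism is a map with
      values in the null line plus a homothety of the plane
      ([curv_form_compatible]).
      The terms by which the Weyl tensor differs from [R] are compatible with
      [S] for every metric ([ricci_weyl_compatible]).
    - The Ricci endomorphism maps [e1] to a multiple of [e2], kills [e2], and is
      [alpha] on the plane; hence [S^3 = alpha S^2] ([wave_mul3]). *)

Set Implicit Arguments.
Unset Strict Implicit.
Unset Printing Implicit Defensive.

Import Order.TTheory GRing.Theory Num.Theory.
Import numFieldNormedType.Exports.
Local Open Scope classical_set_scope.
Local Open Scope ring_scope.

(** * Symmetry of second derivatives *)

Section Directional.
Context {R : realType} {V : normedModType R}.
Implicit Types (F : V -> R) (u v p : V).

Lemma is_derive_line F p v (x : R) : derivable F (p + x *: v) v ->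
  is_derive x 1 (fun y : R => F (p + y *: v)) ('D_v F (p + x *: v)).
Proof.
have E : (fun k => k^-1 *: ((F \o shift (p + x *: v)) (k *: v)
                             - F (p + x *: v)))
   = (fun k => k^-1 *: (((fun y : R => F (p + y *: v)) \o shift x) (k *: 1)
                        - F (p + x *: v))).
  apply/funext => k /=; congr (_ *: (F _ - _)).
  by rewrite /= [k *: 1]mulr1 scalerDl addrCA.
by rewrite /derivable /derive E => ?; split.
Qed.

Lemma MVT_line F p v (t : R) : 0 <= t ->
  (forall x, 0 <= x <= t -> derivable F (p + x *: v) v) ->
  exists2 x, 0 <= x <= t & F (p + t *: v) - F p = 'D_v F (p + x *: v) * t.
Proof.
move=> t0 dF.
have dG x : 0 <= x <= t ->
    is_derive x 1 (fun y : R => F (p + y *: v)) ('D_v F (p + x *: v)).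
  by move=> xt; apply/is_derive_line/dF.
have [x xt E] : exists2 x, x \in `[0, t]%R &
    F (p + t *: v) - F (p + 0 *: v) = 'D_v F (p + x *: v) * (t - 0).
  apply: (@MVT_segment _ (fun y : R => F (p + y *: v))
           (fun y : R => 'D_v F (p + y *: v))) => //.
    by move=> x; rewrite in_itv /= => /andP[x0 xt]; apply: dG; rewrite !ltW.
  apply: derivable_within_continuous => x; rewrite in_itv /= => xt.
  by have [] := dG x xt.
exists x; first by rewrite in_itv in xt.
by rewrite scale0r addr0 subr0 in E.
Qed.

Lemma is_derive_translate F q w u : derivable F (q + w) u ->
  is_derive q u (fun y => F (y + w)) ('D_u F (q + w)).
Proof.
have E : (fun k : R => k^-1 *: ((F \o shift (q + w)) (k *: u) - F (q + w)))
   = (fun k => k^-1 *: (((fun y => F (y + w)) \o shift q) (k *: u)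
                        - F (q + w))).
  by apply/funext => k /=; rewrite addrA.
by rewrite /derivable /derive E => ?; split.
Qed.

(** The second difference of [F] over a parallelogram is an increment, along
    [u], of [q |-> F (q + t v) - F q]; one mean value theorem in the direction
    [u] and another in the direction [v] turn it into a mixed derivative.  The
    left-hand side is symmetric in [u] and [v], whence [derive_comm]. *)
Lemma mixed_difference_MVT F p u v (t : R) : 0 <= t ->
  (forall x y, 0 <= x <= t -> 0 <= y <= t ->
     derivable F (p + x *: u + y *: v) u /\
     derivable ('D_u F) (p + x *: u + y *: v) v) ->
  exists x y, [/\ 0 <= x <= t, 0 <= y <= t &
    F (p + t *: u + t *: v) - F (p + t *: v) - (F (p + t *: u) - F p)
    = 'D_v ('D_u F) (p + x *: u + y *: v) * t ^+ 2].
Proof.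
move=> t0 dF; have t_in : 0 <= t <= t by rewrite lexx t0.
have z_in : 0 <= (0 : R) <= t by rewrite lexx t0.
pose G q := F (q + t *: v) - F q.
have dG x : 0 <= x <= t ->
    is_derive (p + x *: u) u G
      ('D_u F (p + x *: u + t *: v) - 'D_u F (p + x *: u)).
  move=> xt; apply: is_deriveB.
    by apply: is_derive_translate; have [] := dF x t xt t_in.
  by apply: derivableP; have [] := dF x 0 xt z_in; rewrite scale0r addr0.
have [|x xt Ex] := @MVT_line G p u t t0.
  by move=> x /dG [].
have [|y yt Ey] := @MVT_line ('D_u F) (p + x *: u) v t t0.
  by move=> y yt; have [] := dF x y xt yt.
exists x, y; split=> //; have [_ Dx] := dG x xt.
move: Ex; rewrite /G Dx Ey => Ex.
by rewrite expr2 mulrA -Ex; ring.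
Qed.

Lemma near_translate (p w : V) (A : set V) :
  nbhs (p + w) A -> \forall y \near p, A (y + w).
Proof.
have c : (y + w) @[y --> p] --> p + w.
  by apply: cvgD; [exact: cvg_id|exact: cvg_cst].
exact: c.
Qed.

Lemma near_line (p v : V) (A : set V) :
  nbhs p A -> \forall y \near (0 : R), A (p + y *: v).
Proof.
have c : (p + y *: v) @[y --> (0 : R)] --> p + (0 : R) *: v.
  apply: cvgD; first exact: cvg_cst.
  by apply: cvgZ; [exact: cvg_id|exact: cvg_cst].
by rewrite scale0r addr0 in c => pA; exact: c.
Qed.

Lemma near_parallelogram (p u v : V) (A : set V) : nbhs p A ->
  exists2 t : R, 0 < t &
    forall x y, 0 <= x <= t -> 0 <= y <= t -> A (p + x *: u + y *: v).
Proof.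
move=> /nbhs_normP [e /= e0 eA].
have d0 : 0 < 1 + `|u| + `|v| by rewrite -addrA ltr_pwDl ?addr_ge0.
pose t := e / (2 * (1 + `|u| + `|v|)).
have t0 : 0 < t by rewrite divr_gt0 ?mulr_gt0.
exists t => // x y /andP[x0 xt] /andP[y0 yt]; apply: eA => /=.
rewrite -addrA opprD addrA subrr sub0r normrN.
apply: (le_lt_trans (ler_normD _ _)); rewrite !normrZ !ger0_norm //.
apply: (@le_lt_trans _ _ (t * (1 + `|u| + `|v|))).
  rewrite !mulrDr mulr1; apply: lerD; last exact: ler_wpM2r.
  by rewrite ler_wpDl ?ler_wpM2r // ltW.
have -> : t * (1 + `|u| + `|v|) = e / 2 by rewrite /t; field; rewrite gt_eqF.
by rewrite ltr_pdivrMr // ltr_pMr // ltr1n.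
Qed.

(** Symmetry of second derivatives: over every small parallelogram at [p] the
    second difference is a value of either mixed derivative, and both of them
    are continuous at [p]. *)
Lemma derive_comm F p u v (A : set V) : nbhs p A ->
  (forall q, A q -> [/\ derivable F q u, derivable F q v,
     derivable ('D_u F) q v & derivable ('D_v F) q u]) ->
  {for p, continuous ('D_v ('D_u F))} -> {for p, continuous ('D_u ('D_v F))} ->
  'D_v ('D_u F) p = 'D_u ('D_v F) p.
Proof.
move=> pA dF cvu cuv; apply: subr0_eq; apply/eqP.
apply: contraT; rewrite -normr_gt0; set d := `|_ - _| => d0.
have d20 : 0 < d / 2 by rewrite divr_gt0.
move/cvgrPdist_lt: cvu => /(_ _ d20) nvu.
move/cvgrPdist_lt: cuv => /(_ _ d20) nuv.
have [t t0 B] := near_parallelogram u v (filterI pA (filterI nvu nuv)).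
have [|x [y [xt yt E1]]] := @mixed_difference_MVT F p u v t (ltW t0).
  by move=> x y xt yt; have [/dF[]] := B x y xt yt.
have [|y' [x' [yt' xt' E2]]] := @mixed_difference_MVT F p v u t (ltW t0).
  by move=> y' x' yt' xt'; rewrite addrAC; have [/dF[]] := B x' y' xt' yt'.
have [_ [/= B1 _]] := B x y xt yt.
have [_ [_ /= B2]] := B x' y' xt' yt'.
have E : 'D_v ('D_u F) (p + x *: u + y *: v) =
         'D_u ('D_v F) (p + x' *: u + y' *: v).
  have t2 : t ^+ 2 != 0 by rewrite expf_neq0 // gt_eqF.
  rewrite (addrAC p (t *: v)) (addrAC p (y' *: v)) in E2.
  have mixedC (a b c d' : R) : a - b - (c - d') = a - c - (b - d') by ring.
  apply: (mulIf t2); apply: etrans (esym E1) _.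
  exact: etrans (mixedC _ _ _ _) E2.
(* The mixed derivatives share a value that lies within d / 2 of both of their
   values at p. *)
have tri (a b c : R) : `|a - c| < d / 2 -> `|b - c| < d / 2 -> `|a - b| < d.
  move=> ac bc; rewrite -(subrKA c) (splitr d).
  apply: (le_lt_trans (ler_normD _ _)).
  by rewrite [`|c - b|]distrC ltrD.
have B1' :=
  eq_ind _ (fun z => `|'D_v ('D_u F) p - z| < d / 2) B1 _ E.
by have := tri _ _ _ B1' B2; rewrite /d ltxx.
Qed.

End Directional.

(** * Partial derivatives of smooth functions *)

Section PartialDerivatives.
Context {R : realType} (M : set 'rV[R]_4) (Mopen : open M).
Local Notation V := 'rV[R]_4.
Implicit Types (F G : V -> R) (p q : V).

Lemma smooth_pd F i : smooth_on M F -> smooth_on M (pd i F).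
Proof.
by move=> sF s p Mp; have := sF (rcons s i) p Mp; rewrite foldr_rcons.
Qed.

Lemma smooth_derivable F i p :
  smooth_on M F -> M p -> derivable F p (ebase i).
Proof. by move=> sF Mp; have [_] := sF [::] p Mp. Qed.

Lemma smooth_pdC F i j p : smooth_on M F -> M p ->
  pd i (pd j F) p = pd j (pd i F) p.
Proof.
move=> sF Mp; apply: (@derive_comm _ _ F p (ebase j) (ebase i) M).
- exact: open_nbhs_nbhs.
- move=> q Mq; split; apply: smooth_derivable => //; exact: smooth_pd.
- by have [] := sF [:: i; j] p Mp.
- by have [] := sF [:: j; i] p Mp.
Qed.

Lemma eq_pd_open F G i p : (forall q, M q -> F q = G q) -> M p ->
  pd i F p = pd i G p.
Proof.
move=> FG Mp; apply: near_eq_derive.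
by apply: filterS (open_nbhs_nbhs (conj Mopen Mp)) => q; exact: FG.
Qed.

(** If [p] and [q] agree in the coordinates [s] then so do their translates by
    a common small vector; hence near [p] the function [F] coincides with its
    translate by [q - p]. *)
Lemma depends_only_on_pd F s i : smooth_on M F -> depends_only_on M s F ->
  depends_only_on M s (pd i F).
Proof.
move=> sF dF p q Mp Mq pq; have pqE : p + (q - p) = q by rewrite addrC subrK.
have dq : derivable F (p + (q - p)) (ebase i).
  by rewrite pqE; exact: smooth_derivable.
have [_] := is_derive_translate dq.
rewrite pqE /pd => <-; apply: near_eq_derive.
have nq : \forall y \near p, M (y + (q - p)).
  by apply: near_translate; rewrite pqE; exact: open_nbhs_nbhs.
near=> y; apply: dF; [near: y; exact: open_nbhs_nbhs|near: y; exact: nq|].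
by move=> k /pq pqk; rewrite !mxE pqk subrr addr0.
Unshelve. all: by end_near. Qed.

Lemma pd_depends_only_on F s i p : smooth_on M F -> depends_only_on M s F ->
  i \notin s -> M p -> pd i F p = 0.
Proof.
move=> sF dF si Mp; rewrite /pd.
have := @is_derive_line _ _ F p (ebase i) 0.
rewrite scale0r addr0 => /(_ (smooth_derivable sF Mp)) [_ <-].
rewrite -[RHS](@derive_cst _ R R (F p) 0 1); apply: near_eq_derive.
have nM : \forall y \near (0 : R), M (p + y *: ebase i).
  by apply: near_line; exact: open_nbhs_nbhs.
near=> y; apply: dF => //; first by near: y; exact: nM.
move=> k ks; rewrite !mxE /=; case: eqP => [ki|_]; last by rewrite mulr0 addr0.
by rewrite ki (negPf si) in ks.
Unshelve. all: by end_near. Qed.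

End PartialDerivatives.

Section PdRules.
Context {R : realType}.
Local Notation V := 'rV[R]_4.
Implicit Types (F G H f : V -> R) (p : V).

Lemma is_derive_comb3 F G H (a b c : R) p v :
  derivable F p v -> derivable G p v -> derivable H p v ->
  is_derive p v (fun q => a * F q + b * G q + c * H q)
    (a * 'D_v F p + b * 'D_v G p + c * 'D_v H p).
Proof.
move=> /derivableP dF /derivableP dG /derivableP dH.
have dFG := is_deriveD (is_deriveZ a dF) (is_deriveZ b dG).
exact: is_deriveD dFG (is_deriveZ c dH).
Qed.

Lemma pd_comb3 i F G H (a b c : R) p :
  derivable F p (ebase i) -> derivable G p (ebase i) ->
  derivable H p (ebase i) ->
  pd i (fun q => a * F q + b * G q + c * H q) p
  = a * pd i F p + b * pd i G p + c * pd i H p.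
Proof. by move=> dF dG dH; have [] := is_derive_comb3 a b c dF dG dH. Qed.

Lemma pd_comb3_div i F G H f (a b c : R) p : f p != 0 ->
  derivable F p (ebase i) -> derivable G p (ebase i) ->
  derivable H p (ebase i) -> derivable f p (ebase i) ->
  pd i (fun q => (a * F q + b * G q + c * H q) / f q) p
  = (a * pd i F p + b * pd i G p + c * pd i H p) / f p
    - (a * F p + b * G p + c * H p) / f p * pd i f p / f p.
Proof.
move=> f0 dF dG dH df.
have [dN DN] := is_derive_comb3 a b c dF dG dH.
rewrite /pd (deriveM dN (derivableV f0 df)) DN deriveV //.
rewrite /GRing.scale /=; field; exact: f0.
Qed.

Lemma pd_cst i (a : R) p : pd i (fun=> a) p = 0.
Proof. exact: derive_cst. Qed.

End PdRules.

(** * Tensor algebra at a point *)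

Section Tensors.
Context {R : realType}.
Local Notation V := 'rV[R]_4.
Implicit Types (g A B E : 'M[R]_4) (X Y Z : V).

Lemma ev2_ebase A X l : ev2 A X (ebase l) = (X *m A) 0 l.
Proof. by rewrite /ev2 /ebase trmx_delta -colE mxE. Qed.

Lemma sharp4_riemann (g : V -> 'M[R]_4) p X Y Z : g p \in unitmx ->
  sharp4 (g p) (riemann g p) X Y Z = curv_at g p X Y Z.
Proof.
move=> gu; rewrite /sharp4 -[RHS](mulmxK gu); congr (_ *m _).
by apply/rowP => l; rewrite mxE /riemann ev2_ebase.
Qed.

Lemma ev2_sym A X Y : A^T = A -> ev2 A X Y = ev2 A Y X.
Proof.
move=> sA; rewrite /ev2 -[in LHS]sA -[X in X *m _ *m _]trmxK -trmx_mul.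
by rewrite -trmx_mul mxE mulmxA.
Qed.

Lemma ev2_sharp2 g E A X Y :
  ev2 A (sharp2 g E X) Y = ev2 (E *m invmx g *m A) X Y.
Proof. by rewrite /ev2 /sharp2 !mulmxA. Qed.

(** In the cyclic sum every product [A(E X_i, X_j) B(X, X_k)] meets
    [A(E X_j, X_i) B(X, X_k)] with the opposite sign, and likewise with [A] and
    [B] exchanged. *)
Lemma kulkarni_nomizu_compatible g A B E :
  (forall X Y, ev2 A (sharp2 g E X) Y = ev2 A (sharp2 g E Y) X) ->
  (forall X Y, ev2 B (sharp2 g E X) Y = ev2 B (sharp2 g E Y) X) ->
  compatible g (kulkarni_nomizu A B) E.
Proof.
move=> sA sB X X1 X2 X3; rewrite /kulkarni_nomizu.
rewrite (sA X2 X1) (sA X3 X1) (sA X3 X2) (sB X2 X1) (sB X3 X1) (sB X3 X2).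
ring.
Qed.

(** For any metric: the Weyl tensor differs from the curvature tensor by
    Kulkarni-Nomizu products of the metric and the Ricci tensor, and both
    [g (S X, Y) = S(X, Y)] and [S (S X, Y) = S^2(X, Y)] are symmetric. *)
Lemma ricci_weyl_compatible (g : V -> 'M[R]_4) p :
  g p \in unitmx -> (g p)^T = g p -> (ricci g p)^T = ricci g p ->
  compatible (g p) (riemann g p) (ricci g p) ->
  compatible (g p) (weyl g p) (ricci g p).
Proof.
move=> gu sg sS RS X X1 X2 X3; have gS Y Z :
    ev2 (g p) (sharp2 (g p) (ricci g p) Y) Z
    = ev2 (g p) (sharp2 (g p) (ricci g p) Z) Y.
  by rewrite !ev2_sharp2 mulmxKV // ev2_sym.
have SS Y Z : ev2 (ricci g p) (sharp2 (g p) (ricci g p) Y) Z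
    = ev2 (ricci g p) (sharp2 (g p) (ricci g p) Z) Y.
  by rewrite !ev2_sharp2 ev2_sym // !trmx_mul trmx_inv sg sS mulmxA.
have := kulkarni_nomizu_compatible gS SS X X1 X2 X3.
have := kulkarni_nomizu_compatible gS gS X X1 X2 X3.
have := RS X X1 X2 X3; rewrite /weyl.
move: (sharp2 _ _ X1) (sharp2 _ _ X2) (sharp2 _ _ X3) => Y1 Y2 Y3.
move: (riemann g p Y1 X X2 X3) (riemann g p Y2 X X3 X1)
  (riemann g p Y3 X X1 X2).
move: (kulkarni_nomizu (g p) (g p) Y1 X X2 X3)
  (kulkarni_nomizu (g p) (g p) Y2 X X3 X1)
  (kulkarni_nomizu (g p) (g p) Y3 X X1 X2).
move: (kulkarni_nomizu (g p) (ricci g p) Y1 X X2 X3)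
  (kulkarni_nomizu (g p) (ricci g p) Y2 X X3 X1)
  (kulkarni_nomizu (g p) (ricci g p) Y3 X X1 X2).
move: (scalar_curv g p) => k s1 s2 s3 g1 g2 g3 r1 r2 r3 r0 g0 s0.
have -> : r1 - 2^-1 * s1 + k / 12%:R * g1 + (r2 - 2^-1 * s2 + k / 12%:R * g2)
  + (r3 - 2^-1 * s3 + k / 12%:R * g3)
  = (r1 + r2 + r3) - 2^-1 * (s1 + s2 + s3) + k / 12%:R * (g1 + g2 + g3) by ring.
by rewrite r0 g0 s0 !mulr0 subr0 addr0.
Qed.

Lemma otimesE X Y i j : otimes X Y i j = X 0 i * Y 0 j.
Proof. by rewrite mxE big_ord1 mxE. Qed.

Lemma rank_otimes X Y : (\rank (otimes X Y) <= 1)%N.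
Proof. exact: leq_trans (mxrankM_maxl _ _) (rank_leq_col _). Qed.

Lemma tpow2S g A k : (0 < k)%N ->
  tpow2 g A k.+1 = A *m invmx g *m tpow2 g A k.
Proof. by case: k => // k _; rewrite /tpow2 /= exprS mulmxA. Qed.

Lemma tpow2_1 g A : tpow2 g A 1 = A.
Proof. exact: mul1mx. Qed.

End Tensors.

(** * Coordinates and block matrices *)

Lemma sum4 (W : nmodType) (F : 'I_4 -> W) :
  \sum_(i < 4) F i = F c1 + F c2 + F c3 + F c4.
Proof.
rewrite !big_ord_recr /= big_ord0 add0r.
by congr (_ + _ + _ + _); congr F; apply: val_inj.
Qed.

Lemma ord4_ind (P : 'I_4 -> Prop) :
  P c1 -> P c2 -> P c3 -> P c4 -> forall i, P i.
Proof.
move=> P1 P2 P3 P4 [[|[|[|[|//]]]] lt_i4].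
- by rewrite (_ : Ordinal _ = c1) //; apply: val_inj.
- by rewrite (_ : Ordinal _ = c2) //; apply: val_inj.
- by rewrite (_ : Ordinal _ = c3) //; apply: val_inj.
- by rewrite (_ : Ordinal _ = c4) //; apply: val_inj.
Qed.

Definition row4 {R : realType} (a b c d : R) : 'rV[R]_4 :=
  \row_k nth 0 [:: a; b; c; d] k.

(** The matrices with blocks [[a, b], [b, c]] and [d * 1]: the metric, its
    inverse and the Ricci tensor are all of this shape. *)
Definition wave_entry {R : realType} (a b c d : R) (i j : 'I_4) : R :=
  nth 0 (nth [::] [:: [:: a; b; 0; 0]; [:: b; c; 0; 0];
                      [:: 0; 0; d; 0]; [:: 0; 0; 0; d]] i) j.

Definition wave_mx {R : realType} (a b c d : R) : 'M[R]_4 :=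
  \matrix_(i, j) wave_entry a b c d i j.

Section WaveMatrices.
Context {R : realType}.
Local Notation V := 'rV[R]_4.

Lemma ppwaveE (h f : V -> R) p :
  ppwave h f p = wave_mx (- (2 * h p)) 1 0 (- (f p / 2)).
Proof.
by apply/matrixP; do 2![elim/ord4_ind]; rewrite !mxE /wave_entry /=; ring.
Qed.

Lemma row4E (a b c d : R) :
  ((row4 a b c d 0 c1 = a) * (row4 a b c d 0 c2 = b)
   * (row4 a b c d 0 c3 = c) * (row4 a b c d 0 c4 = d))%type.
Proof. by rewrite !mxE. Qed.

Lemma row_sum4 (a : V) (D : 'I_4 -> V) :
  \row_k (\sum_(i < 4) a 0 i * D i 0 k)
  = a 0 c1 *: D c1 + a 0 c2 *: D c2 + a 0 c3 *: D c3 + a 0 c4 *: D c4.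
Proof. by apply/rowP => k; rewrite mxE sum4 !mxE. Qed.

Lemma ev2_wave (a b c d : R) X Y : ev2 (wave_mx a b c d) X Y =
  a * (X 0 c1 * Y 0 c1) + b * (X 0 c1 * Y 0 c2 + X 0 c2 * Y 0 c1)
  + c * (X 0 c2 * Y 0 c2) + d * (X 0 c3 * Y 0 c3 + X 0 c4 * Y 0 c4).
Proof. by rewrite /ev2 mxE sum4 !mxE !sum4 !mxE /wave_entry /=; ring. Qed.

Lemma tr_wave (a b c d : R) : (wave_mx a b c d)^T = wave_mx a b c d.
Proof. by apply/matrixP; do 2![elim/ord4_ind]; rewrite !mxE. Qed.

Lemma wave_mulV (a d : R) : d != 0 ->
  wave_mx a 1 0 d *m wave_mx 0 1 (- a) d^-1 = 1%:M.
Proof.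
by move=> d0; apply/matrixP; do 2![elim/ord4_ind];
  rewrite mxE sum4 !mxE /wave_entry /=; field.
Qed.

Lemma wave_unit (a d : R) : d != 0 -> wave_mx a 1 0 d \in unitmx.
Proof. by move=> d0; have [] := mulmx1_unit (wave_mulV a d0). Qed.

Lemma invmx_wave (a d : R) : d != 0 ->
  invmx (wave_mx a 1 0 d) = wave_mx 0 1 (- a) d^-1.
Proof.
move=> d0; rewrite -[LHS]mulmx1 -(wave_mulV a d0) mulmxA.
by rewrite mulVmx ?mul1mx // wave_unit.
Qed.

(** The middle matrix is the inverse of a metric.  A multiple of [dx^2] raises
    to a nilpotent endomorphism with values in the span of the null vector
    [ebase c2], on which the outer factors vanish: only the second block
    survives. *)
Lemma wave_mul3 (s t c e a b : R) :
  wave_mx s 0 0 a *m wave_mx 0 1 c e *m wave_mx t 0 0 b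
  = wave_mx 0 0 0 (a * e * b).
Proof.
by apply/matrixP; do 2![elim/ord4_ind];
  rewrite !mxE !sum4 !mxE !sum4 !mxE /wave_entry /=; ring.
Qed.

(** The first block has determinant [- b^2]; the second factor in the proof is
    its inverse. *)
Lemma rank_wave2 (t b : R) : b != 0 -> (2 <= \rank (wave_mx t b 0 0))%N.
Proof.
move=> b0; have E : wave_mx t b 0 0 *m wave_mx 0 b^-1 (- (t / b ^+ 2)) 0
    = pid_mx 2.
  apply/matrixP; do 2![elim/ord4_ind];
  by rewrite !mxE !sum4 !mxE /wave_entry /=; field.
have := mxrankM_maxl (wave_mx t b 0 0) (wave_mx 0 b^-1 (- (t / b ^+ 2)) 0).
by rewrite E rank_pid_mx.
Qed.

End WaveMatrices.

(** * The curvature in terms of the Christoffel symbols *)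

Section ConnectionAlgebra.
Context {R : realType}.
Local Notation V := 'rV[R]_4.

(** The vector [Gamma(X, Y)] of the Christoffel symbols of the metric, in terms
    of the values of the first derivatives of [h] and [f] and of [phi = f]. *)
Definition conn_vec (h1 h3 h4 f3 f4 phi : R) (X Y : V) : V :=
  row4 0
    (- (X 0 c1 * Y 0 c1) * h1 + - (X 0 c1 * Y 0 c3 + X 0 c3 * Y 0 c1) * h3
     + - (X 0 c1 * Y 0 c4 + X 0 c4 * Y 0 c1) * h4)
    ((- (2 * X 0 c1 * Y 0 c1) * h3
      + (X 0 c3 * Y 0 c3 - X 0 c4 * Y 0 c4) / 2 * f3
      + (X 0 c3 * Y 0 c4 + X 0 c4 * Y 0 c3) / 2 * f4) / phi)
    ((- (2 * X 0 c1 * Y 0 c1) * h4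
      + (X 0 c3 * Y 0 c4 + X 0 c4 * Y 0 c3) / 2 * f3
      + (X 0 c4 * Y 0 c4 - X 0 c3 * Y 0 c3) / 2 * f4) / phi).

(** The derivative of [conn_vec] in a direction in which [h_i] and [f_i] have
    the derivatives [dh_i] and [df_i], and [phi] has the derivative [dphi];
    [G] is the vector [conn_vec] itself, whose last two components carry the
    factor [1 / phi]. *)
Definition dconn_vec (G : V) (dh1 dh3 dh4 df3 df4 phi dphi : R) (X Y : V) : V :=
  conn_vec dh1 dh3 dh4 df3 df4 phi X Y
  - row4 0 0 (G 0 c3 * dphi / phi) (G 0 c4 * dphi / phi).

(** The curvature operator whose (0,4)-tensor is [curv_form] below, with the
    output index raised by the metric. *)
Definition curv_vec (phi a33 a34 a44 rho : R) (X Y Z : V) : V :=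
  let u3 := X 0 c1 * Y 0 c3 - X 0 c3 * Y 0 c1 in
  let u4 := X 0 c1 * Y 0 c4 - X 0 c4 * Y 0 c1 in
  let w := X 0 c3 * Y 0 c4 - X 0 c4 * Y 0 c3 in
  let A3 := a33 * u3 + a34 * u4 in
  let A4 := a34 * u3 + a44 * u4 in
  row4 0 (- (A3 * Z 0 c3 + A4 * Z 0 c4))
    (- (2 / phi) * (A3 * Z 0 c1 - rho * w * Z 0 c4))
    (- (2 / phi) * (A4 * Z 0 c1 + rho * w * Z 0 c3)).

(** The coordinate expression [Y(Gamma(X, Z)) + Gamma(Y, Gamma(X, Z)) -
    (X <-> Y)] of the curvature.  The first derivatives [f_1], [f_2], [h_2] and
    their derivatives are zero, and [hij] and [fij] stand for either of two
    equal mixed derivatives. *)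
Lemma curvature_identity
    (h1 h3 h4 f3 f4 phi h11 h13 h14 h33 h34 h44 f33 f34 f44 : R)
    (X Y Z : V) : phi != 0 ->
  let G := conn_vec h1 h3 h4 f3 f4 phi in
  let D X Y Z :=
    Y 0 c1 *: dconn_vec (G X Z) h11 h13 h14 0 0 phi 0 X Z
    + Y 0 c3 *: dconn_vec (G X Z) h13 h33 h34 f33 f34 phi f3 X Z
    + Y 0 c4 *: dconn_vec (G X Z) h14 h34 h44 f34 f44 phi f4 X Z in
  D X Y Z + G Y (G X Z) - (D Y X Z + G X (G Y Z))
  = curv_vec phi
     ((- (f3 * h3) + f4 * h4 + 2 * phi * h33) / (2 * phi))
     ((- (f3 * h4) - f4 * h3 + 2 * phi * h34) / (2 * phi))
     ((f3 * h3 - f4 * h4 + 2 * phi * h44) / (2 * phi))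
     (- ((f3 ^+ 2 + f4 ^+ 2 - phi * f33 - phi * f44) / (4 * phi)))
     X Y Z.
Proof.
move=> nz G D; rewrite /D {D}.
have addE (A B : V) k : (A + B) 0 k = A 0 k + B 0 k by rewrite mxE.
have oppE (A : V) k : (- A) 0 k = - A 0 k by rewrite mxE.
have scaleE a (A : V) k : (a *: A) 0 k = a * A 0 k by rewrite mxE.
apply/rowP; elim/ord4_ind; rewrite !(addE, oppE, scaleE).
all: rewrite /G /conn_vec /curv_vec !row4E.
all: move: (X 0 c1) (X 0 c2) (X 0 c3) (X 0 c4).
all: move: (Y 0 c1) (Y 0 c2) (Y 0 c3) (Y 0 c4).
all: move: (Z 0 c1) (Z 0 c2) (Z 0 c3) (Z 0 c4).
all: move=> Z1 Z2 Z3 Z4 Y1 Y2 Y3 Y4 X1 X2 X3 X4.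
all: by field; rewrite ?nz.
Qed.

End ConnectionAlgebra.

(** * The algebra of the curvature form *)

Section CurvatureForm.
Context {R : realType}.
Local Notation V := 'rV[R]_4.
Implicit Types (X Y Z : V).

Definition bivec i j X Y : R := X 0 i * Y 0 j - X 0 j * Y 0 i.

Section Form.
Context (h phi a33 a34 a44 rho : R) (phi0 : phi != 0).
Local Notation s := (2 * (a33 + a44) / phi).
Local Notation sigma := (2 * rho / phi).
Local Notation S := (wave_mx s 0 0 sigma).
Local Notation g := (wave_mx (- (2 * h)) 1 0 (- (phi / 2))).
Local Notation curv := (curv_vec phi a33 a34 a44 rho).

(** The symmetric bilinear form on bivectors given by the curvature.  Bivectors
    containing the parallel vector [ebase c2] are in its kernel. *)
Definition bivec_form (u3 u4 w v3 v4 z : R) : R :=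
  a33 * (u3 * v3) + a34 * (u3 * v4 + u4 * v3) + a44 * (u4 * v4) + rho * (w * z).

Definition curv_form : tensor4 R := fun X1 X2 X3 X4 =>
  bivec_form (bivec c1 c3 X1 X2) (bivec c1 c4 X1 X2) (bivec c3 c4 X1 X2)
    (bivec c1 c3 X3 X4) (bivec c1 c4 X3 X4) (bivec c3 c4 X3 X4).

Lemma ev2_curv X Y Z W : ev2 g (curv X Y Z) W = curv_form X Y Z W.
Proof.
rewrite ev2_wave /curv_vec !row4E /curv_form /bivec_form /bivec.
move: (X 0 c1) (X 0 c3) (X 0 c4) => x1 x3 x4.
move: (Y 0 c1) (Y 0 c3) (Y 0 c4) => y1 y3 y4.
move: (Z 0 c1) (Z 0 c3) (Z 0 c4) (W 0 c1) (W 0 c2) (W 0 c3) (W 0 c4).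
by move=> z1 z3 z4 w1 w2 w3 w4; field; rewrite ?phi0.
Qed.

(** The trace that defines the Ricci tensor.  Its value [sigma] on the second
    block makes the curvature operator of that block equal to [X /\_S Y], as for
    any surface; and [s] is, up to the metric factor, the trace of the symmetric
    matrix [a]. *)
Lemma trace_curv :
  \matrix_(j, k) \tr (lin1_mx (fun X => curv X (ebase j) (ebase k))) = S.
Proof.
have bE i j : (delta_mx 0 i : V) 0 j = (j == i)%:R by rewrite mxE.
apply/matrixP => j k; rewrite mxE /mxtrace sum4 ![lin1_mx _ _ _]mxE [RHS]mxE.
rewrite /ebase /curv_vec !row4E !bE.
by elim/ord4_ind: j; elim/ord4_ind: k; rewrite /wave_entry /=; field;
  rewrite ?phi0.
Qed.

(** The derivation of the space of bivectors induced by an endomorphism. *)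
Definition bivec_deriv (T : V -> V) (i j : 'I_4) X Y : R :=
  bivec i j (T X) Y + bivec i j X (T Y).

(** An endomorphism acts on a curvature-like tensor only through its action on
    the two bivectors, which reduces the pseudosymmetry condition to nine
    scalars. *)
Lemma derivation_curv_form (T : V -> V) (X1 X2 X3 X4 : V) :
  - curv_form (T X1) X2 X3 X4 - curv_form X1 (T X2) X3 X4
  - curv_form X1 X2 (T X3) X4 - curv_form X1 X2 X3 (T X4)
  = - (bivec_form (bivec_deriv T c1 c3 X1 X2) (bivec_deriv T c1 c4 X1 X2)
         (bivec_deriv T c3 c4 X1 X2)
         (bivec c1 c3 X3 X4) (bivec c1 c4 X3 X4) (bivec c3 c4 X3 X4)
       + bivec_form (bivec c1 c3 X1 X2) (bivec c1 c4 X1 X2) (bivec c3 c4 X1 X2)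
         (bivec_deriv T c1 c3 X3 X4) (bivec_deriv T c1 c4 X3 X4)
         (bivec_deriv T c3 c4 X3 X4)).
Proof. by rewrite /curv_form /bivec_form /bivec_deriv; ring. Qed.

Lemma deriv_curv X Y Z W :
  [/\ bivec_deriv (curv X Y) c1 c3 Z W
        = sigma * bivec c3 c4 X Y * bivec c1 c4 Z W,
      bivec_deriv (curv X Y) c1 c4 Z W
        = - (sigma * bivec c3 c4 X Y * bivec c1 c3 Z W) &
      bivec_deriv (curv X Y) c3 c4 Z W
        = - (2 / phi) *
         ((a33 * bivec c1 c3 X Y + a34 * bivec c1 c4 X Y) * bivec c1 c4 Z W
          - (a34 * bivec c1 c3 X Y + a44 * bivec c1 c4 X Y) * bivec c1 c3 Z W)].
Proof.
rewrite /bivec_deriv /bivec /curv_vec !row4E.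
move: (X 0 c1) (X 0 c3) (X 0 c4) => x1 x3 x4.
move: (Y 0 c1) (Y 0 c3) (Y 0 c4) => y1 y3 y4.
move: (Z 0 c1) (Z 0 c3) (Z 0 c4) (W 0 c1) (W 0 c3) (W 0 c4).
by move=> z1 z3 z4 w1 w3 w4; split; field; rewrite ?phi0.
Qed.

Lemma deriv_wedge (s' sigma' : R) X Y Z W :
  let T := wedge_op (wave_mx s' 0 0 sigma') X Y in
  [/\ bivec_deriv T c1 c3 Z W
        = sigma' * (bivec c3 c4 X Y * bivec c1 c4 Z W
                    - bivec c1 c4 X Y * bivec c3 c4 Z W),
      bivec_deriv T c1 c4 Z W
        = sigma' * (bivec c1 c3 X Y * bivec c3 c4 Z W
                    - bivec c3 c4 X Y * bivec c1 c3 Z W) &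
      bivec_deriv T c3 c4 Z W
        = s' * (bivec c1 c4 X Y * bivec c1 c3 Z W
                - bivec c1 c3 X Y * bivec c1 c4 Z W)].
Proof.
have TE U k : wedge_op (wave_mx s' 0 0 sigma') X Y U 0 k
    = ev2 (wave_mx s' 0 0 sigma') Y U * X 0 k
      - ev2 (wave_mx s' 0 0 sigma') X U * Y 0 k by rewrite !mxE.
rewrite /bivec_deriv /bivec !TE !ev2_wave.
move: (X 0 c1) (X 0 c2) (X 0 c3) (X 0 c4) (Y 0 c1) (Y 0 c2) (Y 0 c3) (Y 0 c4).
move: (Z 0 c1) (Z 0 c2) (Z 0 c3) (Z 0 c4) (W 0 c1) (W 0 c2) (W 0 c3) (W 0 c4).
by move=> *; split; ring.
Qed.

(** Write [(U3, U4, W)], [(u3, u4, w)] and [(v3, v4, z)] for the bivectors of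
    [(X, Y)], [(X1, X2)] and [(X3, X4)].  The endomorphisms [X /\_S Y] and
    [curv X Y] induce derivations whose difference sends [(u3, u4)] to
    [sigma w (- U4, U3)] and [w] to a combination of [u3] and [u4].  In the
    form, the contributions of these two changes cancel, because
    [rho s = sigma (a33 + a44)] and [2 rho / phi = sigma]. *)
Lemma dot4_curv_form (X1 X2 X3 X4 X Y : V) :
  - curv_form (curv X Y X1) X2 X3 X4 - curv_form X1 (curv X Y X2) X3 X4
  - curv_form X1 X2 (curv X Y X3) X4 - curv_form X1 X2 X3 (curv X Y X4)
  = tachibana4 S curv_form X1 X2 X3 X4 X Y.
Proof.
rewrite /tachibana4 !derivation_curv_form.
have [-> -> ->] := deriv_curv X Y X1 X2.
have [-> -> ->] := deriv_curv X Y X3 X4.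
have [-> -> ->] := deriv_wedge s sigma X Y X1 X2.
have [-> -> ->] := deriv_wedge s sigma X Y X3 X4.
rewrite /bivec_form.
move: (bivec c1 c3 X Y) (bivec c1 c4 X Y) (bivec c3 c4 X Y).
move: (bivec c1 c3 X1 X2) (bivec c1 c4 X1 X2) (bivec c3 c4 X1 X2).
move: (bivec c1 c3 X3 X4) (bivec c1 c4 X3 X4) (bivec c3 c4 X3 X4).
by move=> v3 v4 z u3 u4 w U3 U4 W; field; rewrite ?phi0.
Qed.

Lemma sharp2_wave X : sharp2 g S X
  = row4 0 (s * X 0 c1) (- (2 / phi) * sigma * X 0 c3)
      (- (2 / phi) * sigma * X 0 c4).
Proof.
rewrite /sharp2 invmx_wave ?oppr_eq0 ?mulf_neq0 ?invr_eq0 ?pnatr_eq0 //.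
apply/rowP; elim/ord4_ind; rewrite !mxE !sum4 !mxE !sum4 !mxE /wave_entry /=.
all: by field; rewrite ?phi0.
Qed.

(** The Ricci endomorphism takes [X] to [s X_1] times the null vector, which
    the form ignores, plus a multiple of the projection of [X] to the plane of
    [ebase c3] and [ebase c4].  In the cyclic sum the [a]-terms cancel by the
    symmetry of [a], and the [rho]-terms by the linear relation between three
    vectors of a plane. *)
Lemma curv_form_compatible : compatible g curv_form S.
Proof.
move=> X X1 X2 X3; rewrite !sharp2_wave /curv_form /bivec_form /bivec !row4E.
move: (- (2 / phi) * sigma) s => lam s'.
move: (X 0 c1) (X 0 c3) (X 0 c4) (X1 0 c1) (X1 0 c3) (X1 0 c4).
move: (X2 0 c1) (X2 0 c3) (X2 0 c4) (X3 0 c1) (X3 0 c3) (X3 0 c4).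
by move=> *; ring.
Qed.

End Form.
End CurvatureForm.

(** * Curvature of the generalized pp-wave metric *)

Section PpWave.
Context {R : realType} (M : set 'rV[R]_4) (h f : 'rV[R]_4 -> R).
Context (Mopen : open M) (hsmooth : smooth_on M h) (fsmooth : smooth_on M f)
  (hdep : depends_only_on M [:: c1; c3; c4] h)
  (fdep : depends_only_on M [:: c3; c4] f) (fneq0 : forall p, M p -> f p != 0).
Local Notation V := 'rV[R]_4.
Local Notation g := (ppwave h f).

Lemma pd_ppwave i j l p : M p ->
  pd i (fun q => g q j l) p
  = wave_entry (- (2 * pd i h p)) 0 0 (- (pd i f p / 2)) j l.
Proof.
move=> Mp.
have hi := smooth_derivable (i := i) hsmooth Mp.
have fi := smooth_derivable (i := i) fsmooth Mp.
have -> : (fun q => g q j l) = fun q => - wave_entry 2 0 0 0 j l * h q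
    + - wave_entry 0 0 0 2^-1 j l * f q + wave_entry 0 1 0 0 j l * cst 1 q.
  apply/funext => q; rewrite ppwaveE mxE.
  by elim/ord4_ind: j; elim/ord4_ind: l; rewrite /wave_entry /=; ring.
rewrite (@pd_comb3 _ i h f (cst 1)) ?pd_cst // mulr0 addr0.
move: (pd i h p) (pd i f p) => hi' fi'.
by elim/ord4_ind: j; elim/ord4_ind: l; rewrite /wave_entry /=; ring.
Qed.

Definition ppw_conn (p : V) : V -> V -> V :=
  conn_vec (pd c1 h p) (pd c3 h p) (pd c4 h p) (pd c3 f p) (pd c4 f p) (f p).

Lemma pd_c2_h p : M p -> pd c2 h p = 0.
Proof. by apply: pd_depends_only_on hdep _. Qed.

Lemma pd_c1_f p : M p -> pd c1 f p = 0.
Proof. by apply: pd_depends_only_on fdep _. Qed.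

Lemma pd_c2_f p : M p -> pd c2 f p = 0.
Proof. by apply: pd_depends_only_on fdep _. Qed.

Lemma invmx_ppwave p : M p ->
  invmx (g p) = wave_mx 0 1 (2 * h p) (- (2 / f p)).
Proof.
move=> Mp; have f0 := fneq0 Mp.
rewrite ppwaveE invmx_wave ?oppr_eq0 ?mulf_neq0 ?invr_eq0 ?pnatr_eq0 //.
by rewrite opprK invrN invf_div.
Qed.

Lemma christoffel_ppwave k i j p : M p ->
  christoffel g k i j p = ppw_conn p (ebase i) (ebase j) 0 k.
Proof.
move=> Mp; have f0 := fneq0 Mp.
rewrite /christoffel sum4 invmx_ppwave // !pd_ppwave //.
have h2 := pd_c2_h Mp; have f1 := pd_c1_f Mp; have f2 := pd_c2_f Mp.
rewrite /ppw_conn /conn_vec !mxE; move: f1 f2 h2 f0.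
elim/ord4_ind: i; elim/ord4_ind: j;
  move: (pd c1 h p) (pd c2 h p) (pd c3 h p) (pd c4 h p);
  move: (pd c1 f p) (pd c2 f p) (pd c3 f p) (pd c4 f p) (h p) (f p);
  move=> ? ? f3 f4 h0 f0 h1 ? h3 h4 -> -> -> nz;
  by elim/ord4_ind: k; rewrite /wave_entry /=; field; rewrite ?nz.
Qed.

Lemma nabla_ppwave (X Y : V -> V) p : M p ->
  nabla g X Y p = \row_k (\sum_(i < 4) X p 0 i * pd i (fun q => Y q 0 k) p)
                  + ppw_conn p (X p) (Y p).
Proof.
move=> Mp; have f0 := fneq0 Mp; apply/rowP => k; rewrite [LHS]mxE [RHS]mxE.
under eq_bigr => i _ do rewrite mulrDr; rewrite big_split /=.
congr (_ + _); first by rewrite mxE.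
under eq_bigr => i _ do under eq_bigr => j _ do rewrite christoffel_ppwave //.
rewrite !sum4 /ppw_conn !mxE; move: f0.
move: (pd c1 h p) (pd c3 h p) (pd c4 h p) (pd c3 f p) (pd c4 f p) (f p).
move: (X p 0 c1) (X p 0 c2) (X p 0 c3) (X p 0 c4).
move: (Y p 0 c1) (Y p 0 c2) (Y p 0 c3) (Y p 0 c4).
move=> Y1 Y2 Y3 Y4 X1 X2 X3 X4 h1 h3 h4 f3 f4 f0 nz.
by elim/ord4_ind: k; rewrite /=; field; rewrite ?nz.
Qed.

Definition ppw_dconn i p (X Z : V) : V :=
  dconn_vec (ppw_conn p X Z) (pd i (pd c1 h) p) (pd i (pd c3 h) p)
    (pd i (pd c4 h) p) (pd i (pd c3 f) p) (pd i (pd c4 f) p) (f p) (pd i f p)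
    X Z.

Lemma pd_ppw_conn i p X Z k : M p ->
  pd i (fun q => ppw_conn q X Z 0 k) p = ppw_dconn i p X Z 0 k.
Proof.
move=> Mp; have f0 := fneq0 Mp.
have dh j : derivable (pd j h) p (ebase i).
  by apply: smooth_derivable Mp; apply: smooth_pd.
have df j : derivable (pd j f) p (ebase i).
  by apply: smooth_derivable Mp; apply: smooth_pd.
have fi : derivable f p (ebase i) by apply: smooth_derivable Mp.
have dconnE (A B : V) l : (A - B) 0 l = A 0 l - B 0 l by rewrite !mxE.
rewrite /ppw_dconn /dconn_vec; elim/ord4_ind: k.
- rewrite dconnE row4E [RHS]subr0 /ppw_conn /conn_vec row4E.
  rewrite -[RHS](pd_cst i 0 p).
  by congr (pd i _ p); apply/funext => q; rewrite row4E.
- rewrite dconnE row4E subr0 /ppw_conn /conn_vec row4E -pd_comb3 //.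
  by congr (pd i _ p); apply/funext => q; rewrite row4E.
- rewrite dconnE row4E /ppw_conn /conn_vec !row4E -pd_comb3_div //.
  by congr (pd i _ p); apply/funext => q; rewrite row4E.
- rewrite dconnE row4E /ppw_conn /conn_vec !row4E -pd_comb3_div //.
  by congr (pd i _ p); apply/funext => q; rewrite row4E.
Qed.

(** The components [R_1313], [R_1414], [R_1314] and [R_3434]. *)
Definition ppw_a33 p : R :=
  (- (pd c3 f p * pd c3 h p) + pd c4 f p * pd c4 h p
   + 2 * f p * pd c3 (pd c3 h) p) / (2 * f p).
Definition ppw_a44 p : R :=
  (pd c3 f p * pd c3 h p - pd c4 f p * pd c4 h p
   + 2 * f p * pd c4 (pd c4 h) p) / (2 * f p).
Definition ppw_a34 p : R :=
  (- (pd c3 f p * pd c4 h p) - pd c4 f p * pd c3 h p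
   + 2 * f p * pd c3 (pd c4 h) p) / (2 * f p).

Definition ppw_rho p : R := - (ppw_alpha f p * f p ^+ 2 / 4).

Lemma ppw_conn0 p Z : ppw_conn p 0 Z = 0.
Proof.
apply/rowP => k; rewrite /ppw_conn /conn_vec !mxE; elim/ord4_ind: k => /=;
  by rewrite ?(mul0r, mulr0, oppr0, addr0, subr0).
Qed.

(** [nabla_ppwave] holds at every point of the open set [M], so it may be
    differentiated there. *)
Lemma nabla2_ppwave X Y Z p : M p ->
  nabla g (fun=> Y) (nabla g (fun=> X) (fun=> Z)) p
  = \row_k (\sum_(i < 4) Y 0 i * ppw_dconn i p X Z 0 k)
    + ppw_conn p Y (ppw_conn p X Z).
Proof.
have nablaXZ q : M q -> nabla g (fun=> X) (fun=> Z) q = ppw_conn q X Z.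
  move=> Mq; rewrite nabla_ppwave //= -[RHS]add0r; congr (_ + _).
  by apply/rowP => k; rewrite !mxE big1 // => i _; rewrite pd_cst mulr0.
move=> Mp; rewrite nabla_ppwave //= nablaXZ //; congr (_ + _).
apply/rowP => k; rewrite [LHS]mxE [RHS]mxE.
apply: eq_bigr => i _; congr (_ * _).
rewrite -pd_ppw_conn //; apply: (eq_pd_open Mopen) Mp => q Mq.
by rewrite nablaXZ.
Qed.

Local Opaque pd.

Lemma curv_at_ppwave X Y Z p : M p ->
  curv_at g p X Y Z = curv_vec (f p) (ppw_a33 p) (ppw_a34 p) (ppw_a44 p)
    (ppw_rho p) X Y Z.
Proof.
move=> Mp; have f0 := fneq0 Mp; rewrite /curv_at /curv_op.
rewrite (nabla2_ppwave X Y Z Mp) (nabla2_ppwave Y X Z Mp).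
have -> : lie (fun=> X) (fun=> Y) = fun=> 0.
  apply/funext => q; apply/rowP => k; rewrite !mxE big1 // => i _.
  by rewrite !pd_cst !mulr0 subrr.
have -> : nabla g (fun=> 0) (fun=> Z) p = 0.
  rewrite nabla_ppwave //= ppw_conn0 addr0.
  by apply/rowP => k; rewrite !mxE big1 // => i _; rewrite mxE mul0r.
have pd2h j : pd c2 (pd j h) p = 0.
  have dj := depends_only_on_pd Mopen j hsmooth hdep.
  by apply: (pd_depends_only_on Mopen (smooth_pd j hsmooth) dj).
have pd12f i j : i \notin [:: c3; c4] -> pd i (pd j f) p = 0.
  have dj := depends_only_on_pd Mopen j fsmooth fdep.
  by move=> ij; exact: (pd_depends_only_on Mopen (smooth_pd j fsmooth) dj).
have D1 U W : ppw_dconn c1 p U W = dconn_vec (ppw_conn p U W)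
    (pd c1 (pd c1 h) p) (pd c1 (pd c3 h) p) (pd c1 (pd c4 h) p)
    0 0 (f p) 0 U W.
  by rewrite /ppw_dconn (pd12f c1 c3 isT) (pd12f c1 c4 isT) (pd_c1_f Mp).
have D2 U W : ppw_dconn c2 p U W = 0.
  rewrite /ppw_dconn !(pd2h c1, pd2h c3, pd2h c4).
  rewrite (pd12f c2 c3 isT) (pd12f c2 c4 isT) (pd_c2_f Mp).
  rewrite /dconn_vec /conn_vec.
  move: (ppw_conn p U W) (f p) => G phi.
  by apply/rowP; elim/ord4_ind;
    rewrite !mxE /= ?(mulr0, mul0r, addr0, oppr0).
have D3 U W : ppw_dconn c3 p U W = dconn_vec (ppw_conn p U W)
    (pd c1 (pd c3 h) p) (pd c3 (pd c3 h) p) (pd c3 (pd c4 h) p)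
    (pd c3 (pd c3 f) p) (pd c3 (pd c4 f) p) (f p) (pd c3 f p) U W.
  by rewrite /ppw_dconn (smooth_pdC Mopen c3 c1 hsmooth Mp).
have D4 U W : ppw_dconn c4 p U W = dconn_vec (ppw_conn p U W)
    (pd c1 (pd c4 h) p) (pd c3 (pd c4 h) p) (pd c4 (pd c4 h) p)
    (pd c3 (pd c4 f) p) (pd c4 (pd c4 f) p) (f p) (pd c4 f p) U W.
  rewrite /ppw_dconn (smooth_pdC Mopen c4 c1 hsmooth Mp).
  rewrite (smooth_pdC Mopen c4 c3 hsmooth Mp).
  by rewrite (smooth_pdC Mopen c4 c3 fsmooth Mp).
rewrite addr0 !row_sum4 !D2 !scaler0 !addr0 !D1 !D3 !D4.
rewrite curvature_identity //; congr curv_vec.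
rewrite /ppw_rho /ppw_alpha; move: f0.
move: (pd c3 f p) (pd c4 f p) (pd c3 (pd c3 f) p) (pd c4 (pd c4 f) p)
  (f p).
by move=> f3 f4 f33 f44 phi nz; field.
Qed.

Lemma riemann_ppwave p : M p -> riemann g p =
  curv_form (ppw_a33 p) (ppw_a34 p) (ppw_a44 p) (ppw_rho p).
Proof.
move=> Mp; apply/funext => X1; apply/funext => X2; apply/funext => X3.
apply/funext => X4; rewrite /riemann curv_at_ppwave // ppwaveE ev2_curv //.
exact: fneq0.
Qed.

Lemma ricci_ppwave p : M p -> ricci g p =
  wave_mx (2 * (ppw_a33 p + ppw_a44 p) / f p) 0 0 (2 * ppw_rho p / f p).
Proof.
move=> Mp; rewrite -(trace_curv _ (ppw_a34 p)) ?fneq0 //.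
apply/matrixP => j k; rewrite !mxE; congr (\tr _); congr lin1_mx.
by apply/funext => X; rewrite curv_at_ppwave.
Qed.

End PpWave.

(** * The curvature properties *)

Theorem theorem3p1 (R : realType) (M : set 'rV[R]_4) (h f : 'rV[R]_4 -> R)
    (Mopen : open M) (Mconn : connected M)
    (hsmooth : smooth_on M h) (fsmooth : smooth_on M f)
    (hdep : depends_only_on M [:: c1; c3; c4] h)
    (fdep : depends_only_on M [:: c3; c4] f)
    (hneq0 : forall p, M p -> h p != 0) (fneq0 : forall p, M p -> f p != 0) :
  let g := ppwave h f in
  let S := ricci g in
  let a := ppw_alpha f in
  let eta := @ppw_eta R in
  let delta := ppw_delta h f in
  ricci_gen_pseudosymmetric M g (cst 1)
  /\
  (* Where alpha = 0 the rank is at most 1. *)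
  (two_quasi_Einstein M g
   /\ (forall p, M p -> (\rank (S p - a p *: g p)%R <= 2)%N)
   /\ (forall p, M p -> a p != 0 -> \rank (S p - a p *: g p)%R = 2%N))
  /\
  (chaki_gen_quasi_Einstein M g
   /\ forall p, M p ->
        S p = a p *: g p + otimes eta eta
              + (otimes eta (delta p) + otimes (delta p) eta))
  /\
  (riemann_compatible M g S /\ weyl_compatible M g S)
  /\
  (Ein3 M g
   /\ forall p, M p ->
        tpow2 (g p) (S p) 3
        = ((pd c3 f p ^+ 2 + pd c4 f p ^+ 2
            - f p * (pd c3 (pd c3 f) p + pd c4 (pd c4 f) p)) / f p ^+ 3)
          *: tpow2 (g p) (S p) 2).
Proof.
move=> g S a eta delta.
have RE p : M p -> riemann g p = curv_form (ppw_a33 h f p) (ppw_a34 h f p)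
    (ppw_a44 h f p) (ppw_rho f p) by exact: riemann_ppwave.
have SE p : M p -> S p = wave_mx (2 * (ppw_a33 h f p + ppw_a44 h f p) / f p)
    0 0 (2 * ppw_rho f p / f p) by exact: ricci_ppwave.
have gE p : g p = wave_mx (- (2 * h p)) 1 0 (- (f p / 2)) by exact: ppwaveE.
have gu p : M p -> g p \in unitmx.
  move=> Mp; rewrite gE wave_unit // oppr_eq0.
  by rewrite mulf_neq0 ?invr_eq0 ?pnatr_eq0 ?fneq0.
have chaki p : M p -> S p = a p *: g p + otimes eta eta
    + (otimes eta (delta p) + otimes (delta p) eta).
  move=> Mp; have f0 := fneq0 p Mp; apply/matrixP => i j.
  have addE (A B : 'M[R]_4) : (A + B) i j = A i j + B i j by rewrite mxE.
  have scaleE c (A : 'M[R]_4) : (c *: A) i j = c * A i j by rewrite mxE.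
  rewrite !addE scaleE !otimesE SE // gE ![wave_mx _ _ _ _ _ _]mxE.
  rewrite /a /delta /ppw_delta /ppw_rho /ppw_a33 /ppw_a44 /ppw_alpha.
  rewrite /eta /ppw_eta /ebase !mxE; move: f0.
  move: (pd c3 (pd c3 h) p) (pd c4 (pd c4 h) p) (pd c3 (pd c3 f) p)
    (pd c4 (pd c4 f) p).
  move: (pd c3 h p) (pd c4 h p) (pd c3 f p) (pd c4 f p) (h p) (f p).
  move=> h3 h4 f3 f4 h0 phi h33 h44 f33 f44 nz.
  clear addE scaleE.
  by elim/ord4_ind: i; elim/ord4_ind: j; rewrite /wave_entry /=; field;
    rewrite ?nz.
have rank_le p : M p -> (\rank (S p - a p *: g p)%R <= 2)%N.
  move=> Mp.
  have -> : S p - a p *: g p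
      = otimes eta (eta + delta p) + otimes (delta p) eta.
    have cancel (A B C : 'M[R]_4) : A + B + C - A = B + C.
      by apply/eqP; rewrite subr_eq -addrA addrC.
    by rewrite chaki // cancel addrA /otimes -mulmxDr.
  apply: leq_trans (mxrank_add _ _) _.
  exact: leq_add (rank_otimes _ _) (rank_otimes _ _).
have rank_ge p : M p -> a p != 0 -> (2 <= \rank (S p - a p *: g p)%R)%N.
  move=> Mp a0; have f0 := fneq0 p Mp.
  have -> : S p - a p *: g p = wave_mx
      (2 * (ppw_a33 h f p + ppw_a44 h f p) / f p + a p * (2 * h p)) (- a p) 0 0.
    rewrite SE // gE; move: f0; rewrite /ppw_rho -/(a p).
    move: (ppw_a33 h f p) (ppw_a44 h f p) (a p) (f p) (h p).
    move=> a33 a44 al phi h0 nz; apply/matrixP; do 2![elim/ord4_ind];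
    by rewrite !mxE /wave_entry /=; field; rewrite ?nz.
  by rewrite rank_wave2 // oppr_eq0.
have cube p : M p -> tpow2 (g p) (S p) 3
    = ((pd c3 f p ^+ 2 + pd c4 f p ^+ 2
        - f p * (pd c3 (pd c3 f) p + pd c4 (pd c4 f) p)) / f p ^+ 3)
      *: tpow2 (g p) (S p) 2.
  move=> Mp; have f0 := fneq0 p Mp.
  have -> : (pd c3 f p ^+ 2 + pd c4 f p ^+ 2
      - f p * (pd c3 (pd c3 f) p + pd c4 (pd c4 f) p)) / f p ^+ 3 = a p.
    by rewrite mulrDr opprD addrA.
  rewrite tpow2S // tpow2S // tpow2_1.
  rewrite SE // gE invmx_wave; last first.
    by rewrite oppr_eq0 mulf_neq0 ?invr_eq0 ?pnatr_eq0.
  rewrite !wave_mul3 /ppw_rho -/(a p).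
  move: (a p) (f p) f0 => al phi nz; apply/matrixP; do 2![elim/ord4_ind];
  by rewrite !mxE /wave_entry /=; field; rewrite ?nz.
have RS p : M p -> compatible (g p) (riemann g p) (S p).
  move=> Mp; rewrite RE // SE // gE; exact: curv_form_compatible (fneq0 p Mp).
split.
  move=> p Mp X1 X2 X3 X4 X Y; rewrite mul1r /dot4 !sharp4_riemann ?gu //.
  rewrite !(curv_at_ppwave Mopen hsmooth fsmooth hdep fdep fneq0) // RE //.
  rewrite -/S SE //.
  by apply: dot4_curv_form; exact: fneq0.
split.
  split; first by move=> p Mp; exists (a p); exact: rank_le.
  split=> // p Mp a0; apply/eqP; rewrite eqn_leq rank_le //=; exact: rank_ge.
split.
  split=> //; exists a, (cst 1), (cst 1), (cst eta), delta => p Mp.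
  by rewrite /chaki_form !scale1r; exact: chaki.
split.
  split=> // p Mp; apply: ricci_weyl_compatible; rewrite ?gu //.
  - by rewrite gE tr_wave.
  - by rewrite -/S SE // tr_wave.
  - exact: RS.
split=> //.
exists (fun p => - ((pd c3 f p ^+ 2 + pd c4 f p ^+ 2
        - f p * (pd c3 (pd c3 f) p + pd c4 (pd c4 f) p)) / f p ^+ 3)).
exists (cst 0), (cst 0) => p Mp.
by rewrite cube // scaleNr subrr !scale0r !addr0.
Qed.
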